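(* Let $X$ be a separable real Hilbert space, $T>0$, and let $A$ generate a $C_0$-semigroup on $X$ such that either $A^*=A$ with $\sup\sigma(A)=-\sigma_0<0$, or $A^*=-A$. Let $(b,g,h)\in\mathcal{G}_2\cap\mathcal{G}_3$. Let $\Pi(\cdot)=\begin{pmatrix}P(\cdot)&\Gamma(\cdot)^*\\ \Gamma(\cdot)&\bar P(\cdot)\end{pmatrix}$ be a mild solution of the Lyapunov differential equation $$\dot\Pi(t)+\Pi(t)[\mathbb{A}-\mathbb{M}(t)]+[\mathbb{A}-\mathbb{M}(t)]^*\Pi(t)+\mathbb{Q}(t)=0,\quad t\in[0,T],$$ for some $\mathbb{M}(\cdot)=\begin{pmatrix}M(\cdot)&0\\0&-\bar M(\cdot)^*\end{pmatrix}$, $\mathbb{Q}(\cdot)=\begin{pmatrix}Q_0(\cdot)&\Theta(\cdot)^*\\ \Theta(\cdot)&\bar Q_0(\cdot)\end{pmatrix}$. Then $\Pi(\cdot)$ is both a type (I) and a type (II) Lyapunov operator for $(b,g,h)$ if, for some $\delta>0$, the following hold: $$\bar P(0)\le-\delta,\qquad P(T)\ge\delta,$$ $$P(T)+h_y(y)^*\Gamma(T)+\Gamma(T)^*h_y(y)+h_y(y)^*\bar P(T)h_y(y)\ge\delta,\qquad\forall y\in X,$$ $$\Pi(t)\mathbb{M}(t)+\mathbb{M}(t)^*\Pi(t)-\mathbb{Q}(t)\le-\delta,\qquad t\in[0,T],$$ $$\Pi(t)\mathbb{B}(t,y,\psi)+\mathbb{B}(t,y,\psi)^*\Pi(t)+\Pi(t)\mathbb{M}(t)+\mathbb{M}(t)^*\Pi(t)-\mathbb{Q}(t)\le-\delta,\qquad(t,y,\psi)\in[0,T]\times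 X\times X,$$ where $\mathbb{B}(t,y,\psi)=\begin{pmatrix}b_y(t,y,\psi)&b_\psi(t,y,\psi)\\-g_y(t,y,\psi)&-g_\psi(t,y,\psi)\end{pmatrix}$.
   Context: $\mathcal{L}(\cdot)$: bounded operators; $\mathbb{S}(\cdot)$: bounded self-adjoint operators; $F\ge\delta$ means $F-\delta I\ge0$ and $F\le-\delta$ means $-F\ge\delta$; scalars in operator matrices denote multiples of the identity. $\mathbb{A}=\begin{pmatrix}A&0\\0&-A^*\end{pmatrix}$. $\mathcal{G}_2$: triples $(b,g,h)$ with $b,g:[0,T]\times X\times X\to X$, $h:X\to X$ continuous, for which there is $L>0$ with $\|b(t,0,0)\|,\|g(t,0,0)\|\le L$, $\|b(t,y,\psi)-b(t,\bar y,\bar\psi)\|\le L\|y-\bar y\|+L\|\psi-\bar\psi\|$, likewise for $g$, and $\|h(y)-h(\bar y)\|\le L\|y-\bar y\|$. $\mathcal{G}_3$: triples of continuous maps, locally Lipschitz in $(y,\psi)$, such that $(y,\psi)\mapsto(b(t,y,\psi),g(t,y,\psi),h(y))$ is Fréchet differentiable with continuous Fréchet derivatives. In the Lyapunov differential equation $M,\bar M,\Theta:[0,T]\to\mathcal{L}(X)$, $Q_0,\bar Q_0:[0,T]\to\mathbb{S}(X)$ are bounded and strongly measurable. $\Pi$ (strongly continuous, $\mathbb{S}(X\times X)$-valued) is a mild solution if $$P(t)=e^{A^*(T-t)}P(T)e^{A(T-t)}-\int_t^Te^{A^*(s-t)}[PM+M^*P-Q_0](s)e^{A(s-t)}ds,$$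 $$\bar P(t)=e^{At}\bar P(0)e^{A^*t}-\int_0^te^{A(t-s)}[\bar P\bar M^*+\bar M\bar P+\bar Q_0](s)e^{A^*(t-s)}ds,$$ and: if $A^*=A$, $\Gamma(t)=\Gamma(T)+\int_t^T[\bar M\Gamma-\Gamma M+\Theta](s)ds$ with $\Gamma(t)\mathcal{D}(A)\subseteq\mathcal{D}(A)$, $\Gamma(t)Az=A\Gamma(t)z$ for $z\in\mathcal{D}(A)$; if $A^*=-A$, $\Gamma(t)=e^{-A(T-t)}\Gamma(T)e^{A(T-t)}+\int_t^Te^{-A(s-t)}[\bar M\Gamma-\Gamma M+\Theta](s)e^{A(s-t)}ds$. Set $\mathbb{H}^\rho(t,\Pi,y,\psi)=\rho[\Pi\mathbb{B}(t,y,\psi)+\mathbb{B}(t,y,\psi)^*\Pi]+\Pi\mathbb{M}(t)+\mathbb{M}(t)^*\Pi$. A strongly continuous $\Pi:[0,T]\to\mathbb{S}(X\times X)$ is a type (I) Lyapunov operator of $(b,g,h)\in\mathcal{G}_3$ if there are $\mathbb{Q}=\begin{pmatrix}Q_0&\Theta^*\\ \Theta&\bar Q_0\end{pmatrix}$ and $\mathbb{M}=\begin{pmatrix}M&0\\0&-\bar M^*\end{pmatrix}$, with $M,\bar M,\Theta:[0,T]\to\mathcal{L}(X)$ and $Q_0,\bar Q_0:[0,T]\to\mathbb{S}(X)$ bounded and strongly measurable, such that $\Pi$ is a mild solution of the Lyapunov differential equation and for some constants $\mu,K>0$: (a) $\Pi(0)+\begin{pmatrix}-K&0\\0&0\end{pmatrix}\le0$;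 (b) $\begin{pmatrix}I&\rho h_y(y)^*\\0&I\end{pmatrix}\Pi(T)\begin{pmatrix}I&0\\ \rho h_y(y)&I\end{pmatrix}+\begin{pmatrix}-\mu h_y(y)^*h_y(y)&0\\0&K\end{pmatrix}\ge0$ for all $y\in X$, $\rho\in[0,1]$; (c) $\begin{pmatrix}\mathbb{H}^\rho(t,\Pi(t),y,\psi)-\mathbb{Q}(t)+\mu\begin{pmatrix}g_y(t,y,\psi)^*g_y(t,y,\psi)&0\\0&0\end{pmatrix}&\Pi(t)\\ \Pi(t)&-K\end{pmatrix}\le0$ for all $(t,y,\psi)\in[0,T]\times X\times X$, $\rho\in[0,1]$. It is a type (II) Lyapunov operator if instead (a) holds together with (b') $\begin{pmatrix}I&\rho h_y(y)^*\\0&I\end{pmatrix}\Pi(T)\begin{pmatrix}I&0\\ \rho h_y(y)&I\end{pmatrix}+\begin{pmatrix}0&0\\0&K\end{pmatrix}\ge0$ for all $y\in X$, $\rho\in[0,1]$; (c') $\begin{pmatrix}\mathbb{H}^\rho(t,\Pi(t),y,\psi)-\mathbb{Q}(t)+\mu\begin{pmatrix}0&0\\0&b_\psi(t,y,\psi)^*b_\psi(t,y,\psi)\end{pmatrix}&\Pi(t)\\ \Pi(t)&-K\end{pmatrix}\le0$ for all $(t,y,\psi)\in[0,T]\times X\times X$, $\rho\in[0,1]$. *)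

(* Defs.v *)
From HB Require Import structures.
From mathcomp Require Import all_boot all_order all_algebra sesquilinear.
From mathcomp Require Import all_classical all_reals all_analysis.

Set Implicit Arguments.
Unset Strict Implicit.
Unset Printing Implicit Defensive.

Import Order.TTheory GRing.Theory Num.Theory.
Import numFieldNormedType.Exports.

Local Open Scope classical_set_scope.
Local Open Scope ring_scope.

Section Operators.
Context {R : realType}.

Definition separable (X : topologicalType) := exists2 D : set X, countable D & dense D.

(* For V = X * X the norm of V is the maximum norm, which is equivalent to the
   Hilbert norm given by [pair_ip] below: both define the same operators. *)
Definition bounded_op (V : normedModType R) (F : V -> V) :=
  linear F /\ exists C : R, forall x, `|F x| <= C * `|x|.

(* The adjoint of a bounded operator; it exists (Riesz) when ip is a Hilbert
   space inner product, and [get] picks it pointwise. *)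
Definition adj (V : normedModType R) (ip : V -> V -> R) (F : V -> V) : V -> V :=
  fun y => get [set z | forall x, ip (F x) y = ip x z].

Definition selfadjoint_op (V : normedModType R) (ip : V -> V -> R) (F : V -> V) :=
  bounded_op F /\ forall x y, ip (F x) y = ip x (F y).

Definition scal (V : normedModType R) (c : R) : V -> V := fun x => c *: x.

(* [ge_op ip F c] is F >= c I, and [le_op ip F c] is - F >= - c I. They are only
   used for self-adjoint operators F. *)
Definition ge_op (V : normedModType R) (ip : V -> V -> R) (F : V -> V) (c : R) :=
  forall z, 0 <= ip (F z - c *: z) z.

Definition le_op (V : normedModType R) (ip : V -> V -> R) (F : V -> V) (c : R) :=
  ge_op ip (\- F) (- c).

Definition pair_ip (V : normedModType R) (ip : V -> V -> R) (z w : V * V) : R :=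
  ip z.1 w.1 + ip z.2 w.2.

(* The operator matrix with rows (F11, F12) and (F21, F22). *)
Definition blk (V : normedModType R) (F11 F12 F21 F22 : V -> V) (z : V * V) : V * V :=
  (F11 z.1 + F12 z.2, F21 z.1 + F22 z.2).

Definition blk11 (V : normedModType R) (F : V * V -> V * V) : V -> V :=
  fun x => (F (x, 0)).1.
Definition blk21 (V : normedModType R) (F : V * V -> V * V) : V -> V :=
  fun x => (F (x, 0)).2.
Definition blk22 (V : normedModType R) (F : V * V -> V * V) : V -> V :=
  fun x => (F (0, x)).2.

End Operators.

Section Bochner.
Context {R : realType} {X : normedModType R}.

Record simple_fun := SimpleFun {
  sf_len : nat;
  sf_set : nat -> set R;
  sf_val : nat -> X;
  sf_meas : forall i, measurable (sf_set i) }.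

Definition sf_eval (s : simple_fun) (t : R) : X :=
  \sum_(i < sf_len s) (\1_(sf_set s i) t : R) *: sf_val s i.

Definition sf_integral (a b : R) (s : simple_fun) : X :=
  \sum_(i < sf_len s)
    fine (lebesgue_measure (sf_set s i `&` `[a, b])) *: sf_val s i.

Definition strongly_measurable (a b : R) (f : R -> X) :=
  exists s : nat -> simple_fun,
    {ae lebesgue_measure, forall t : R, a <= t <= b ->
       sf_eval (s n) t @[n --> \oo] --> f t}.

(* f is Bochner integrable on [a, b] and v is its integral. *)
Definition bochner_integral (a b : R) (f : R -> X) (v : X) :=
  strongly_measurable a b f /\
  exists s : nat -> simple_fun,
    ((\int[lebesgue_measure]_(t in `[a, b]) (`|f t - sf_eval (s n) t|%:E))%E
       @[n --> \oo] --> 0%E) /\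
    (sf_integral a b (s n) @[n --> \oo] --> v).

(* Operator-valued functions are integrated, and are strongly measurable, in the
   strong operator sense. *)
Definition op_integral (a b : R) (F : R -> X -> X) (V : X -> X) :=
  forall z, bochner_integral a b (fun s => F s z) (V z).

Definition bounded_strongly_measurable (T : R) (F : R -> X -> X) :=
  [/\ forall t : R, 0 <= t <= T -> bounded_op (F t),
      exists C : R, forall t : R, 0 <= t <= T -> forall z, `|F t z| <= C * `|z| &
      forall z, strongly_measurable 0 T (fun t => F t z)].

End Bochner.

Section Semigroups.
Context {R : realType} {X : normedModType R}.
Variable ip : X -> X -> R.

Definition C0_semigroup (S : R -> X -> X) :=
  [/\ forall t : R, 0 <= t -> bounded_op (S t),
      S 0 = idfun,
      forall s t : R, 0 <= s -> 0 <= t -> S (s + t) = S s \o S t &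
      forall x, S t x @[t --> 0^'+] --> x].

(* An unbounded operator is given by its domain D and a function A that is only
   meaningful on D. *)
Definition generator (S : R -> X -> X) (D : set X) (A : X -> X) :=
  forall x y, (D x /\ A x = y) <->
    (t^-1 *: (S t x - x) @[t --> 0^'+] --> y).

(* y is in the domain of the adjoint of (D, A), and w is its image. *)
Definition adjoint_graph (D : set X) (A : X -> X) (y w : X) :=
  forall x, D x -> ip (A x) y = ip x w.

Definition unb_selfadjoint (D : set X) (A : X -> X) :=
  dense D /\ forall y w, adjoint_graph D A y w <-> (D y /\ w = A y).

Definition unb_skewadjoint (D : set X) (A : X -> X) :=
  dense D /\ forall y w, adjoint_graph D A y w <-> (D y /\ w = - A y).

Definition resolvent_set (D : set X) (A : X -> X) : set R :=
  [set l | exists F : X -> X, [/\ bounded_op F,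
     forall x, D (F x) /\ l *: F x - A (F x) = x &
     forall x, D x -> F (l *: x - A x) = x]].

Definition spectrum (D : set X) (A : X -> X) : set R := ~` resolvent_set D A.

End Semigroups.

Section Coefficients.
Context {R : realType} {X : normedModType R}.

Definition G2 (T : R) (b g : R -> X -> X -> X) (h : X -> X) :=
  [/\ {within [set p : R * (X * X) | 0 <= p.1 <= T],
         continuous (fun p : R * (X * X) => b p.1 p.2.1 p.2.2)},
      {within [set p : R * (X * X) | 0 <= p.1 <= T],
         continuous (fun p : R * (X * X) => g p.1 p.2.1 p.2.2)},
      continuous h &
      exists2 L : R, 0 < L &
      [/\ forall t : R, 0 <= t <= T -> `|b t 0 0| <= L /\ `|g t 0 0| <= L,
          forall t : R, 0 <= t <= T -> forall y psi y' psi',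
            `|b t y psi - b t y' psi'| <= L * `|y - y'| + L * `|psi - psi'|,
          forall t : R, 0 <= t <= T -> forall y psi y' psi',
            `|g t y psi - g t y' psi'| <= L * `|y - y'| + L * `|psi - psi'| &
          forall y y', `|h y - h y'| <= L * `|y - y'|]].

Definition locally_lipschitz2 (T : R) (f : R -> X -> X -> X) :=
  forall p : X * X, exists L : R, exists2 U : set (X * X), nbhs p U &
    forall t : R, 0 <= t <= T -> forall q q', U q -> U q' ->
      `|f t q.1 q.2 - f t q'.1 q'.2| <=
        L * `|q.1 - q'.1| + L * `|q.2 - q'.2|.

Definition locally_lipschitz1 (f : X -> X) :=
  forall y : X, exists L : R, exists2 U : set X, nbhs y U &
    forall u u', U u -> U u' -> `|f u - f u'| <= L * `|u - u'|.

Definition frechet_C1 (V W : normedModType R) (f : V -> W) :=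
  (forall p, differentiable f p) /\
  (forall p (e : R), 0 < e ->
     \forall q \near p, forall v, `|'d f q v - 'd f p v| <= e * `|v|).

Definition G3 (T : R) (b g : R -> X -> X -> X) (h : X -> X) :=
  [/\ [/\ {within [set p : R * (X * X) | 0 <= p.1 <= T],
             continuous (fun p : R * (X * X) => b p.1 p.2.1 p.2.2)},
          {within [set p : R * (X * X) | 0 <= p.1 <= T],
             continuous (fun p : R * (X * X) => g p.1 p.2.1 p.2.2)} &
          continuous h],
      [/\ locally_lipschitz2 T b, locally_lipschitz2 T g & locally_lipschitz1 h] &
      [/\ forall t : R, 0 <= t <= T -> frechet_C1 (fun p : X * X => b t p.1 p.2),
          forall t : R, 0 <= t <= T -> frechet_C1 (fun p : X * X => g t p.1 p.2) &
          frechet_C1 h]].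

Definition d_y (f : R -> X -> X -> X) (t : R) (y psi : X) : X -> X :=
  'd (fun u => f t u psi) y.
Definition d_psi (f : R -> X -> X -> X) (t : R) (y psi : X) : X -> X :=
  'd (fun v => f t y v) psi.

End Coefficients.

Section Lyapunov.
Context {R : realType} {X : normedModType R}.
Variables (ip : X -> X -> R) (T : R).
(* S is the semigroup e^{A t} generated by (D, A). *)
Variables (S : R -> X -> X) (D : set X) (A : X -> X).

Definition lyapunov_data (M Mbar Theta Q0 Qbar0 : R -> X -> X) :=
  [/\ bounded_strongly_measurable T M, bounded_strongly_measurable T Mbar,
      bounded_strongly_measurable T Theta, bounded_strongly_measurable T Q0 &
      bounded_strongly_measurable T Qbar0] /\
  (forall t : R, 0 <= t <= T ->
     selfadjoint_op ip (Q0 t) /\ selfadjoint_op ip (Qbar0 t)).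

(* The semigroup e^{A^* t} is t |-> adj ip (S t). *)
Definition mild_solution (M Mbar Theta Q0 Qbar0 : R -> X -> X)
    (Pi : R -> X * X -> X * X) :=
  let P t := blk11 (Pi t) in
  let Gamma t := blk21 (Pi t) in
  let Pbar t := blk22 (Pi t) in
  let F s := (Mbar s \o Gamma s) \- (Gamma s \o M s) \+ Theta s in
  [/\ [/\ forall t : R, 0 <= t <= T -> selfadjoint_op (pair_ip ip) (Pi t) &
          forall z, {within `[0, T], continuous (fun t => Pi t z)}],
      forall t : R, 0 <= t <= T -> exists2 V : X -> X,
        op_integral t T
          (fun s => adj ip (S (s - t)) \o
             ((P s \o M s) \+ (adj ip (M s) \o P s) \- Q0 s) \o S (s - t)) V &
        P t = (adj ip (S (T - t)) \o P T \o S (T - t)) \- V,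
      forall t : R, 0 <= t <= T -> exists2 V : X -> X,
        op_integral 0 t
          (fun s => S (t - s) \o
             ((Pbar s \o adj ip (Mbar s)) \+ (Mbar s \o Pbar s) \+ Qbar0 s) \o
             adj ip (S (t - s))) V &
        Pbar t = (S t \o Pbar 0 \o adj ip (S t)) \- V,
      unb_selfadjoint ip D A -> forall t : R, 0 <= t <= T ->
        (exists2 V : X -> X, op_integral t T F V & Gamma t = Gamma T \+ V) /\
        (forall z, D z -> D (Gamma t z) /\ Gamma t (A z) = A (Gamma t z)) &
      unb_skewadjoint ip D A -> exists Sm : R -> X -> X,
        [/\ C0_semigroup Sm, generator Sm D (\- A) &
            forall t : R, 0 <= t <= T -> exists2 V : X -> X,
              op_integral t T (fun s => Sm (s - t) \o F s \o S (s - t)) V &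
              Gamma t = (Sm (T - t) \o Gamma T \o S (T - t)) \+ V]].

Definition op_M (M Mbar : R -> X -> X) (t : R) : X * X -> X * X :=
  blk (M t) (scal 0) (scal 0) (\- adj ip (Mbar t)).

Definition op_Q (Theta Q0 Qbar0 : R -> X -> X) (t : R) : X * X -> X * X :=
  blk (Q0 t) (adj ip (Theta t)) (Theta t) (Qbar0 t).

Definition op_B (b g : R -> X -> X -> X) (t : R) (y psi : X) : X * X -> X * X :=
  blk (d_y b t y psi) (d_psi b t y psi)
      (\- d_y g t y psi) (\- d_psi g t y psi).

(* F1 F2 + F2^* F1 *)
Definition lyap_sym (F1 F2 : X * X -> X * X) : X * X -> X * X :=
  (F1 \o F2) \+ (adj (pair_ip ip) F2 \o F1).

Definition op_H (b g : R -> X -> X -> X) (M Mbar : R -> X -> X) (rho t : R)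
    (Pit : X * X -> X * X) (y psi : X) : X * X -> X * X :=
  (rho \*: lyap_sym Pit (op_B b g t y psi)) \+ lyap_sym Pit (op_M M Mbar t).

Definition lyap_initial (K : R) (Pi : R -> X * X -> X * X) :=
  le_op (pair_ip ip)
    (Pi 0 \+ blk (scal (- K)) (scal 0) (scal 0) (scal 0)) 0.

Definition terminal_form (rho : R) (dh : X -> X) (PiT : X * X -> X * X) :
    X * X -> X * X :=
  blk (scal 1) (rho \*: adj ip dh) (scal 0) (scal 1) \o PiT \o
  blk (scal 1) (scal 0) (rho \*: dh) (scal 1).

Definition lyapunov_type_I (b g : R -> X -> X -> X) (h : X -> X)
    (Pi : R -> X * X -> X * X) :=
  G3 T b g h /\
  exists M Mbar Theta Q0 Qbar0 : R -> X -> X,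
  [/\ lyapunov_data M Mbar Theta Q0 Qbar0,
      mild_solution M Mbar Theta Q0 Qbar0 Pi &
  exists mu K : R, [/\ 0 < mu, 0 < K, lyap_initial K Pi,
    forall y (rho : R), 0 <= rho <= 1 ->
      ge_op (pair_ip ip)
        (terminal_form rho ('d h y) (Pi T) \+
         blk ((- mu) \*: (adj ip ('d h y) \o 'd h y)) (scal 0) (scal 0) (scal K)) 0 &
    forall (t : R) y psi (rho : R), 0 <= t <= T -> 0 <= rho <= 1 ->
      le_op (pair_ip (pair_ip ip))
        (blk (op_H b g M Mbar rho t (Pi t) y psi \- op_Q Theta Q0 Qbar0 t \+
              (mu \*: blk (adj ip (d_y g t y psi) \o d_y g t y psi)
                          (scal 0) (scal 0) (scal 0)))
             (Pi t) (Pi t) (scal (- K))) 0]].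

Definition lyapunov_type_II (b g : R -> X -> X -> X) (h : X -> X)
    (Pi : R -> X * X -> X * X) :=
  G3 T b g h /\
  exists M Mbar Theta Q0 Qbar0 : R -> X -> X,
  [/\ lyapunov_data M Mbar Theta Q0 Qbar0,
      mild_solution M Mbar Theta Q0 Qbar0 Pi &
  exists mu K : R, [/\ 0 < mu, 0 < K, lyap_initial K Pi,
    forall y (rho : R), 0 <= rho <= 1 ->
      ge_op (pair_ip ip)
        (terminal_form rho ('d h y) (Pi T) \+
         blk (scal 0) (scal 0) (scal 0) (scal K)) 0 &
    forall (t : R) y psi (rho : R), 0 <= t <= T -> 0 <= rho <= 1 ->
      le_op (pair_ip (pair_ip ip))
        (blk (op_H b g M Mbar rho t (Pi t) y psi \- op_Q Theta Q0 Qbar0 t \+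
              (mu \*: blk (scal 0) (scal 0) (scal 0)
                          (adj ip (d_psi b t y psi) \o d_psi b t y psi)))
             (Pi t) (Pi t) (scal (- K))) 0]].

End Lyapunov.

(* Main.v *)
Require Import Defs.
From HB Require Import structures.
From mathcomp Require Import all_boot all_order all_algebra sesquilinear.
From mathcomp Require Import all_classical all_reals all_analysis.
From mathcomp Require Import ring lra measurable_realfun.
Import Order.TTheory GRing.Theory Num.Theory.
Import numFieldNormedType.Exports.
Local Open Scope classical_set_scope.
Local Open Scope ring_scope.

(** Every condition on a Lyapunov operator is a bound on a quadratic form, and
    the hypotheses give such bounds with a margin delta. The margin pays for all
    that the definitions of the two types add.

    In the interior condition the form of H^rho - Q is the convex combination,
    with weights rho and 1 - rho, of the two forms assumed to be at most - delta,
    so it is itself at most - delta. The derivatives g_y and b_psi are bounded by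
    the Lipschitz constant L of the coefficients ([lipschitz_diff]); for
    mu = delta / (2 L^2) the term with mu uses up half of the margin, and the
    other half absorbs the off-diagonal blocks Pi(t) through Young's inequality
    as soon as K is large ([schur_le_op]). One K serves all t because the norm of
    Pi(t) is bounded uniformly in t, by the uniform boundedness principle
    ([pair_strongly_continuous_bounded]). The initial condition is handled in the
    same way ([initial_le]).

    The terminal condition is where the differential equation enters. Its form
    at (x, 0) is, up to the term with mu,
      rho |-> <P(T) x, x> + 2 rho <Gamma(T) x, k> + rho^2 <Pbar(T) k, k>
    with k = h_y(y) x. It is at least delta |x|^2 at rho = 0 and rho = 1 by
    assumption, hence on [0, 1] if it is concave, that is if Pbar(T) <= 0
    ([terminal_lower], [terminal_ge]). This sign propagates from t = 0: the
    (2,2) block of Pi M + M^* Pi - Q <= - delta says that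
      Pbar Mbar^* + Mbar Pbar + Qbar0 >= delta,
    and the mild formula expresses Pbar(t) as a congruence transform of
    Pbar(0) <= 0 minus the integral of congruence transforms of these positive
    operators ([mild_solution22_le0]).

    Three tools support this: the Riesz representation theorem, which makes the
    adjoints of bounded operators exist ([riesz], [bounded_has_adj]); the
    positivity of the Bochner integral under bounded linear forms
    ([bochner_integral_ge0]); and Young's inequality for positive semidefinite
    symmetric bilinear forms ([inner_young]). *)

(** * Positive semidefinite symmetric bilinear forms *)

(** Only semidefiniteness is asked, so that the same lemmas serve the inner
    product of X and the forms that it induces on X * X and (X * X) * (X * X),
    whatever the norms of these products are. *)
Definition semi_inner {R : realType} {V : lmodType R} (f : V -> V -> R) :=
  [/\ forall c x y z, f (c *: x + y) z = c * f x z + f y z,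
      forall x y, f x y = f y x & forall x, 0 <= f x x].

Section SemiInner.
Context {R : realType} {V : lmodType R} {f : V -> V -> R}.
Hypothesis f_inner : semi_inner f.

Lemma innerC x y : f x y = f y x. Proof. by case: f_inner. Qed.

Lemma inner_ge0 x : 0 <= f x x. Proof. by case: f_inner. Qed.

Lemma innerDl x y z : f (x + y) z = f x z + f y z.
Proof. by case: f_inner => lf _ _; rewrite -[x]scale1r lf mul1r scale1r. Qed.

Lemma inner0l z : f 0 z = 0.
Proof. by apply: (addrI (f 0 z)); rewrite -innerDl !addr0. Qed.

Lemma innerZl c x z : f (c *: x) z = c * f x z.
Proof. by case: f_inner => lf _ _; rewrite -[c *: x]addr0 lf inner0l addr0. Qed.

Lemma innerNl x z : f (- x) z = - f x z.
Proof. by rewrite -scaleN1r innerZl mulN1r. Qed.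

Lemma innerBl x y z : f (x - y) z = f x z - f y z.
Proof. by rewrite innerDl innerNl. Qed.

Lemma innerDr x y z : f z (x + y) = f z x + f z y.
Proof. by rewrite !(innerC z) innerDl. Qed.

Lemma inner0r z : f z 0 = 0. Proof. by rewrite innerC inner0l. Qed.

Lemma innerZr c x z : f z (c *: x) = c * f z x.
Proof. by rewrite !(innerC z) innerZl. Qed.

Lemma innerNr x z : f z (- x) = - f z x.
Proof. by rewrite !(innerC z) innerNl. Qed.

Definition innerE := (innerDl, innerDr, innerNl, innerNr, innerZl, innerZr,
  inner0l, inner0r).

(** Expand the nonnegative number f (e x - y) (e x - y) and divide by e. *)
Lemma inner_young x y e : 0 < e -> 2 * f x y <= e * f x x + e^-1 * f y y.
Proof.
move=> e0; have := inner_ge0 (e *: x - y).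
rewrite !innerE (innerC y x) => h.
rewrite -(ler_pM2l e0) mulrDr !mulrA divff ?gt_eqF//; lra.
Qed.

Lemma inner_youngN x y e : 0 < e -> - (2 * f x y) <= e * f x x + e^-1 * f y y.
Proof.
move=> e0; have := @inner_young (- x) y e e0.
by rewrite !innerE opprK mulrN.
Qed.

End SemiInner.

Lemma semi_inner_dot {R : realType} {X : normedModType R}
  (ip : {dot X for idfun}) :
  (forall x : X, ip x x = `|x| ^+ 2) -> semi_inner ip.
Proof.
move=> ipn; split => [c x y z|x y|x]; last by rewrite ipn sqr_ge0.
- by rewrite linearDl linearZl_LR.
- by rewrite hermC expr0 mul1r.
Qed.

Lemma semi_inner_pair {R : realType} {V : normedModType R} {ip : V -> V -> R} :
  semi_inner ip -> semi_inner (pair_ip ip).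
Proof.
move=> ipI; split => [c x y z|x y|x]; rewrite /pair_ip.
- rewrite /= !(innerE ipI); ring.
- by rewrite !(innerC ipI x.1) (innerC ipI x.2).
- by rewrite addr_ge0 // inner_ge0.
Qed.

(** * Linear forms and the Riesz representation theorem *)

Lemma linear_at0 {R : realType} {V W : normedModType R} {F : V -> W} :
  linear F -> F 0 = 0.
Proof. by move=> lF; have := lF (-1) 0 0; rewrite scaler0 addr0 scaleN1r addNr. Qed.

Section LinearForm.
Context {R : realType} {X : normedModType R} {phi : X -> R}.
Hypothesis phi_lin : forall c x y, phi (c *: x + y) = c * phi x + phi y.

Lemma linform0 : phi 0 = 0.
Proof. by have := phi_lin 1 0 0; rewrite scaler0 addr0 mul1r; lra. Qed.

Lemma linformZ c x : phi (c *: x) = c * phi x.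
Proof. by rewrite -[c *: x]addr0 phi_lin linform0 addr0. Qed.

Lemma linformD x y : phi (x + y) = phi x + phi y.
Proof. by rewrite -[x]scale1r phi_lin mul1r scale1r. Qed.

Lemma linformB x y : phi (x - y) = phi x - phi y.
Proof. by rewrite addrC -scaleN1r phi_lin mulN1r addrC. Qed.

Lemma linform_sum n (F : 'I_n -> X) :
  phi (\sum_(i < n) F i) = \sum_(i < n) phi (F i).
Proof. exact: (big_morph phi linformD linform0). Qed.

Lemma linform_cvg (C : R) (u : nat -> X) (z : X) :
  (forall x, `|phi x| <= C * `|x|) -> u n @[n --> \oo] --> z ->
  phi (u n) @[n --> \oo] --> phi z.
Proof.
move=> phib uz; apply/cvgrPdist_le => e e0; have := uz => /cvgrPdist_le.
have C0 : 0 < `|C| + 1 by rewrite ltr_wpDl.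
move=> /(_ (e / (`|C| + 1)) (divr_gt0 e0 C0)); apply: filterS => n.
rewrite ler_pdivlMr// -linformB => /(le_trans _); apply.
apply: (le_trans (phib _)); rewrite mulrC ler_wpM2l//.
by rewrite (le_trans (ler_norm C))// lerDl.
Qed.
End LinearForm.

Section Riesz.
Context {R : realType} {X : completeNormedModType R} {ip : X -> X -> R}.
Hypotheses (ipI : semi_inner ip) (ip_norm : forall x, ip x x = `|x| ^+ 2).

(** Young's inequality at e = |y| / |x|, where its right-hand side is smallest. *)
Lemma ip_norm_le x y : `|ip x y| <= `|x| * `|y|.
Proof.
have [->|x0] := eqVneq x 0; first by rewrite (inner0l ipI) !normr0 mul0r.
have [->|y0] := eqVneq y 0; first by rewrite (inner0r ipI) !normr0 mulr0.
have xp : 0 < `|x| by rewrite normr_gt0.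
have yp : 0 < `|y| by rewrite normr_gt0.
have e0 : 0 < `|y| / `|x| by rewrite divr_gt0.
have h1 := inner_young ipI x y _ e0; have h2 := inner_youngN ipI x y _ e0.
rewrite !ip_norm in h1 h2.
have E : `|y| / `|x| * `|x| ^+ 2 + (`|y| / `|x|)^-1 * `|y| ^+ 2
       = 2 * (`|x| * `|y|).
  by field; rewrite !gt_eqF.
rewrite {}E in h1 h2.
by rewrite ler_norml; lra.
Qed.

(** The functional J x = |x|^2 - 2 phi x is bounded below, and by the
    parallelogram law every minimizing sequence is Cauchy. The limit z minimizes
    J, so the first variation of J vanishes at z, which says phi = <., z>. *)
Lemma riesz (phi : X -> R) (C : R) :
  (forall c x y, phi (c *: x + y) = c * phi x + phi y) ->
  (forall x, `|phi x| <= C * `|x|) -> exists z, forall x, phi x = ip x z.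
Proof.
move=> phil phib.
have phiZ := linformZ phil; have phiD := linformD phil.
pose J x := ip x x - 2 * phi x.
have Jlb x : - C ^+ 2 <= J x.
  have := phib x; rewrite ler_norml /J ip_norm => /andP[_ h].
  have := sqr_ge0 (`|x| - C); rewrite sqrrB; nra.
pose m := inf (range J).
have hinf : has_inf (range J).
  by split; [exists (J 0); exists 0|exists (- C ^+ 2) => _ [x _ <-]; exact: Jlb].
have mJ x : m <= J x by apply: ge_inf; [case: hinf|exists x].
have /choice[u uP] : forall n : nat, exists x, J x < m + n.+1%:R^-1.
  move=> n; have n0 : 0 < n.+1%:R^-1 :> R by rewrite invr_gt0.
  by have [_ [x _ <-] h] := inf_adherent n0 hinf; exists x.
(* The parallelogram law, with J ((x + y) / 2) >= m. *)
have par x y : `|x - y| ^+ 2 <= 2 * (J x - m) + 2 * (J y - m).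
  have := mJ (2^-1 *: (x + y)); rewrite /J -!ip_norm !(innerE ipI) phiZ phiD.
  rewrite (innerC ipI y x); lra.
have ucvg : cvgn u.
  apply/cauchy_cvgP/cauchy_ballP => e e0.
  have e2 : 0 < e ^+ 2 / 4 by rewrite divr_gt0 ?exprn_gt0.
  pose B := [set x | J x < m + e ^+ 2 / 4].
  have FB : nbhs (u @ \oo) B.
    have [N _ NP] := near_infty_natSinv_lt (PosNum e2).
    exists N => // n /NP /= h; have := uP n; rewrite /B /=.
    by set i := _^-1 in h *; have {}h : i < e ^+ 2 / 4 := h; lra.
  exists (B, B) => //= -[x y] /= [Bx By].
  rewrite -ball_normE /ball_ /= -(@ltr_pXn2r _ 2) ?nnegrE ?(ltW e0)//.
  apply: (le_lt_trans (par _ _)); move: Bx By; rewrite /B /=; lra.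
pose z := limn u; exists z.
have Jz : J z <= m.
  have phic : phi (u n) @[n --> \oo] --> phi z by exact: linform_cvg phib ucvg.
  have Jc : J (u n) @[n --> \oo] --> J z.
    rewrite /J; under eq_fun do rewrite ip_norm.
    rewrite ip_norm; apply: cvgB; last by apply: cvgMr.
    by rewrite expr2; under eq_fun do rewrite expr2; apply: cvgM; apply: cvg_norm.
  apply/ler_addgt0Pr => e e0; apply: (cvgr_to_le Jc).
  have := near_infty_natSinv_lt (PosNum e0); apply: filterS => n /= h.
  by have := uP n; set i := _^-1 in h *; have {}h : i < e := h; lra.
have key v t : 0 <= 2 * t * (ip v z - phi v) + t ^+ 2 * ip v v.
  have := le_trans Jz (mJ (z + t *: v)).
  rewrite /J !(innerE ipI) phiD phiZ (innerC ipI z v) expr2; lra.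
move=> v; apply/eqP; rewrite eq_sym -subr_eq0; apply/eqP.
set d := ip v z - phi v.
(* The optimal step is - d / |v|^2; adding 1 avoids the case v = 0. *)
have := key v (- d / (ip v v + 1)); rewrite -/d.
set q := ip v v; have q0 : 0 <= q by exact: inner_ge0.
have -> : 2 * (- d / (q + 1)) * d + (- d / (q + 1)) ^+ 2 * q
  = - (d ^+ 2 * (q + 2) / (q + 1) ^+ 2) by field; rewrite gt_eqF //; lra.
rewrite oppr_ge0 => h; apply/eqP; rewrite -sqrf_eq0 eq_le sqr_ge0 andbT.
have [q1 q2] : 0 < q + 1 /\ 0 < q + 2 by lra.
by move: h; rewrite pmulr_lle0 ?invr_gt0 ?exprn_gt0// pmulr_lle0.
Qed.
End Riesz.

(** * Positivity of the Bochner integral *)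

(** The integral of a nonnegative function is a supremum over the simple
    functions below it, hence monotone for arbitrary functions. This avoids
    proving that t |-> |f t - s t| is measurable for f strongly measurable and s
    simple. *)
Lemma ge0_le_integral_nonmeasurable {R : realType} d (T : measurableType d)
  (mu : {measure set T -> \bar R}) (D : set T) (f g : T -> \bar R) :
  (forall x, D x -> 0 <= f x)%E -> (forall x, D x -> f x <= g x)%E ->
  (\int[mu]_(x in D) f x <= \int[mu]_(x in D) g x)%E.
Proof.
move=> f0 fg.
have g0 x : D x -> (0 <= g x)%E by move=> Dx; exact: le_trans (f0 _ Dx) (fg _ Dx).
rewrite !ge0_integralE//; apply: le_ereal_sup => _ [h /= hf <-]; exists h => //= x.
by apply: (le_trans (hf x)); apply: lee_restrict.
Qed.

Section Bochner.
Context {R : realType} {X : normedModType R}.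
Variables (phi : X -> R) (C : R).
Hypothesis phi_lin : forall c x y, phi (c *: x + y) = c * phi x + phi y.
Hypothesis phi_bound : forall x, `|phi x| <= C * `|x|.

Lemma sf_integral_linform (a b : R) (s : @simple_fun R X) :
  (\int[lebesgue_measure]_(t in `[a, b]) (phi (sf_eval s t))%:E)%E
    = (phi (sf_integral a b s))%:E /\
  lebesgue_measure.-integrable `[a, b] (fun t => (phi (sf_eval s t))%:E).
Proof.
pose k i : R -> \bar R :=
  fun t => ((phi (sf_val s i))%:E * (\1_(sf_set s i) t)%:E)%E.
have E : (fun t => (phi (sf_eval s t))%:E)
       = (fun t => \sum_(i < sf_len s) k i t)%E.
  apply/funext => t; rewrite /sf_eval (linform_sum phi_lin) -sumEFin.
  by apply: eq_bigr => i _; rewrite (linformZ phi_lin) EFinM muleC.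
have finab i : (lebesgue_measure (sf_set s i `&` `[a, b]%classic) < +oo)%E.
  apply: (@le_lt_trans _ _ (lebesgue_measure (`[a, b]%classic : set R))).
    by apply: le_measure; rewrite ?inE//; apply: measurableI => //; exact: sf_meas.
  by rewrite lebesgue_measure_itv /=; case: ifP; rewrite ?ltry// -EFinB ltry.
have ind i : lebesgue_measure.-integrable `[a, b] (fun t => (\1_(sf_set s i) t)%:E).
  apply/integrableP; split.
    by apply/measurable_EFinP/measurable_indic; exact: sf_meas.
  under eq_integral do rewrite gee0_abs ?lee_fin//.
  by rewrite integral_indic//; [exact: finab|exact: sf_meas].
have kint i : lebesgue_measure.-integrable `[a, b] (k i) by apply: integrableZl.
rewrite E; split; last by apply: integrable_sum.
rewrite integral_sum// /sf_integral (linform_sum phi_lin) -sumEFin.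
apply: eq_bigr => i _; rewrite (linformZ phi_lin) /k integralZl//.
rewrite integral_indic//; last exact: sf_meas.
by rewrite EFinM muleC fineK// ge0_fin_numE.
Qed.

(** If simple functions s_n approximate f in mean, then where phi (s_n) is
    negative its size is at most C |f - s_n|, because phi (f) >= 0. So
    phi of the integral of s_n is at least - C times the mean error, which tends
    to 0. *)
Lemma bochner_integral_ge0 (a b : R) (f : R -> X) (v : X) :
  bochner_integral a b f v -> (forall t, a <= t <= b -> 0 <= phi (f t)) ->
  0 <= phi v.
Proof.
move=> [_ [s [sf sv]]] phif.
have C0 : 0 < `|C| + 1 by rewrite ltr_wpDl.
(* |C| + 1 bounds phi and is positive, so that one can divide by it. *)
have key n : (((`|C| + 1)^-1 * - phi (sf_integral a b (s n)))%:E <=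
   \int[lebesgue_measure]_(t in `[a, b]) (`|f t - sf_eval (s n) t|%:E))%E.
  have [E I] := sf_integral_linform a b (s n).
  pose F t := (phi (sf_eval (s n) t))%:E.
  have mF : measurable_fun `[a, b] F by case/integrableP: I.
  have h : ((- phi (sf_integral a b (s n)))%:E <=
            \int[lebesgue_measure]_(t in `[a, b]) (F^\- t))%E.
    rewrite EFinN leeNl -E [leRHS]integralE -[leLHS]add0e leeD2r//.
    by apply: integral_ge0 => t _; exact: funepos_ge0.
  rewrite EFinM; apply: (@le_trans _ _ ((`|C| + 1)^-1%:E *
      \int[lebesgue_measure]_(t in `[a, b]) (F^\- t))%E).
    by apply: lee_wpmul2l => //; rewrite lee_fin invr_ge0 ltW.
  rewrite -ge0_integralZl//; last first.
    exact: measurable_funeneg.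
  apply: ge0_le_integral_nonmeasurable => t; rewrite /= in_itv /= => tab.
    by rewrite mule_ge0// ?funeneg_ge0// lee_fin invr_ge0 ltW.
  rewrite funenegE /F -EFinN -EFin_max -EFinM lee_fin.
  rewrite ler_pdivrMl// ge_max; apply/andP; split; last by rewrite mulr_ge0// ltW.
  have := phi_bound (f t - sf_eval (s n) t); rewrite (linformB phi_lin) ler_norml.
  have := phif _ tab; have := ler_norm C; have := normr_ge0 (f t - sf_eval (s n) t).
  by move=> h1 h2 h3 /andP[_ h4]; nra.
have [finI cvgI] := (fine_cvgP _ _).1 sf.
have cphi : phi (sf_integral a b (s n)) @[n --> \oo] --> phi v.
  exact: linform_cvg phi_lin _ _ _ phi_bound sv.
have := ler_cvg_to (cvgM (cvg_cst (`|C| + 1)^-1) (cvgN cphi)) cvgI.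
rewrite pmulr_rle0 ?invr_gt0// oppr_le0; apply.
apply: filterS finI => n fI /=.
by rewrite -lee_fin fineK //; exact: key.
Qed.
End Bochner.

(** * Derivatives of Lipschitz maps *)

Lemma lipschitz_diff {R : realType} {V W : normedModType R} (f : V -> W) (y : V)
  (L : R) :
  (forall u, `|f u - f y| <= L * `|u - y|) -> differentiable f y ->
  forall v, `|'d f y v| <= L * `|v|.
Proof.
move=> fL fd v; rewrite -deriveE//.
have dv := @diff_derivable _ _ _ _ _ v fd.
have h : `|k^-1 *: (f (k *: v + y) - f y)| @[k --> (0 : R)^'] --> `|'D_v f y|.
  exact: cvg_norm dv.
apply: (cvgr_to_le h); near=> k => /=.
have k0 : 0 < `|k| by rewrite normr_gt0; near: k; exact: nbhs_dnbhs_neq.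
by rewrite normrZ normfV ler_pdivrMl// (le_trans (fL _))// addrK normrZ mulrCA.
Unshelve. all: by end_near. Qed.

Lemma frechet_partial_differentiable {R : realType} {X : normedModType R}
  (f : R -> X -> X -> X) (t : R) (y psi : X) :
  frechet_C1 (fun p : X * X => f t p.1 p.2) ->
  differentiable (fun u => f t u psi) y /\ differentiable (fun v => f t y v) psi.
Proof.
move=> [df _]; split.
  apply: (@differentiable_comp _ _ _ _ (fun u : X => (u, psi))
    (fun p : X * X => f t p.1 p.2)).
    by apply: differentiable_pair.
  exact: df.
apply: (@differentiable_comp _ _ _ _ (fun v : X => (y, v))
  (fun p : X * X => f t p.1 p.2)).
  by apply: differentiable_pair.
exact: df.
Qed.

(** * Adjoints and operator inequalities *)

(** Stated pointwise, in the form in which [adj] selects its values. *)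
Definition has_adj {R : realType} {V : normedModType R} (f : V -> V -> R)
  (F : V -> V) := forall y, exists z, forall x, f (F x) y = f x z.

Lemma adjE {R : realType} {V : normedModType R} {f : V -> V -> R} {F : V -> V} :
  has_adj f F -> forall x y, f (F x) y = f x (adj f F y).
Proof. by move=> aF x y; apply: (getPex (aF y)). Qed.

Lemma bounded_has_adj {R : realType} {X : completeNormedModType R}
  {ip : X -> X -> R} (ipI : semi_inner ip) (ipn : forall x, ip x x = `|x| ^+ 2)
  (F : X -> X) : bounded_op F -> has_adj ip F.
Proof.
move=> [lF [C bF]] y.
apply: (riesz ipI ipn (fun x => ip (F x) y) (C * `|y|)) => [c u v|x].
  by rewrite lF !(innerE ipI).
by rewrite (le_trans (ip_norm_le ipI ipn _ _))// mulrAC ler_wpM2r.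
Qed.

Section Quadratic.
Context {R : realType} {V : normedModType R} {f : V -> V -> R}.
Hypothesis fI : semi_inner f.

Lemma ge_opP (F : V -> V) c : ge_op f F c <-> forall z, c * f z z <= f (F z) z.
Proof. by split=> h z; have := h z; rewrite !(innerE fI) subr_ge0. Qed.

Lemma le_opP (F : V -> V) c : le_op f F c <-> forall z, f (F z) z <= c * f z z.
Proof.
by split=> h z; have := h z; rewrite /= !(innerE fI) mulNr opprK addrC subr_ge0.
Qed.

End Quadratic.

(** A quantitative Schur complement: the cross term 2 f (P z) w is at most
    (d / c) f (P z) (P z) + (c / d) f w w, where the first summand is at most
    d f z z and the second at most K f w w. *)
Lemma schur_le_op {R : realType} {V : normedModType R} {f : V -> V -> R}
  (fI : semi_inner f) (F P : V -> V) (d c K : R) : 0 < d -> 0 < c -> c / d <= K ->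
  (forall z w, f (P z) w = f z (P w)) ->
  (forall z, f (P z) (P z) <= c * f z z) ->
  le_op f F (- d) -> le_op (pair_ip f) (blk F P P (scal (- K))) 0.
Proof.
move=> d0 c0 Kge Psa Pb /(le_opP fI) Fd.
apply/(le_opP (semi_inner_pair fI)) => -[z w].
rewrite mul0r /pair_ip /blk /scal /= !(innerE fI) (Psa w z) (innerC fI w).
have := inner_young fI (P z) w _ (divr_gt0 d0 c0); rewrite invf_div => h.
have h1 : d / c * f (P z) (P z) <= d * f z z.
  by rewrite -mulrA ler_pM2l// mulrC ler_pdivrMr// mulrC.
have h2 : c / d * f w w <= K * f w w by rewrite ler_wpM2r ?inner_ge0.
have := Fd z; lra.
Qed.



(** * Uniform bounds for strongly continuous families *)

(** Orbits over the compact interval are bounded, so the uniform boundedness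
    principle applies. *)
Lemma strongly_continuous_bounded {R : realType} {V : completeNormedModType R}
  {W : normedModType R} (T : R) (F : R -> V -> W) :
  (forall t, 0 <= t <= T ->
     linear (F t) /\ exists C, forall x, `|F t x| <= C * `|x|) ->
  (forall x, {within `[0, T], continuous (fun t => F t x)}) ->
  exists2 c, 0 < c & forall t, 0 <= t <= T -> forall x, `|F t x| <= c * `|x|.
Proof.
move=> lF cF.
have [//|x|M HM] := @Banach_Steinhauss _ _ _ (F @` [set t | 0 <= t <= T]) _ _ 1.
- move=> _ [t /lF[lt [C Ct]] <-]; split=> // r; exists (`|C| * `|r|) => x xr.
  rewrite (le_trans (Ct x))// (le_trans (ler_norm _))// normrM normr_id.
  by rewrite ler_wpM2l// (le_trans xr)// ler_norm.
- have /compact_bounded[M [_ HM]] :=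
    continuous_compact (cF x) (@segment_compact _ 0 T).
  exists (M + 1) => _ [t t0T <-]; apply: HM; first by rewrite ltrDl.
  by exists t => //=; rewrite in_itv.
exists (`|M| + 1) => [|t tT x]; first by rewrite ltr_wpDl.
have [lt _] := lF t tT.
have F0 := linear_at0 lt.
have FZ a u : F t (a *: u) = a *: F t u by have := lt a u 0; rewrite F0 !addr0.
have [->|x0] := eqVneq x 0; first by rewrite F0 !normr0 mulr0.
have xp : 0 < `|x| by rewrite normr_gt0.
have := HM _ (ex_intro2 _ _ t tT erefl) (`|x|^-1 *: x).
rewrite FZ !normrZ normfV normr_id mulVf ?gt_eqF// ler_pdivrMl// mulrC.
move=> /(_ (lexx _)) h.
by rewrite (le_trans h)// ler_wpM2r// (le_trans (ler_norm _))// lerDl.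
Qed.

(** The two columns of Pi(t) are families of operators on the complete space X,
    to which the uniform bound applies; the norm of X * X is the maximum norm,
    which differs from the Hilbert norm by at most a factor 2 in the square. *)
Lemma pair_strongly_continuous_bounded {R : realType}
  {X : completeNormedModType R} {ip : X -> X -> R}
  (ipn : forall x, ip x x = `|x| ^+ 2) (T : R) (Pi : R -> X * X -> X * X) :
  (forall t : R, 0 <= t <= T -> bounded_op (Pi t)) ->
  (forall z, {within `[0, T], continuous (fun t => Pi t z)}) ->
  exists2 c, 0 < c & forall t, 0 <= t <= T -> forall z,
    pair_ip ip (Pi t z) (Pi t z) <= c * pair_ip ip z z.
Proof.
move=> bPi cPi.
have nl (x : X) : `|(x, 0 : X)| = `|x|.
  by rewrite prod_normE /= normr0; apply/max_idPl.
have nr (x : X) : `|(0 : X, x)| = `|x|.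
  by rewrite prod_normE /= normr0; apply/max_idPr.
have [|//|c1 c10 H1] := @strongly_continuous_bounded R X (X * X)%type T
  (fun t x => Pi t (x, 0)).
  move=> t /bPi[lt [C Ct]]; split; last by exists C => x; rewrite -nl.
  move=> a x y; rewrite -lt; congr (Pi t _).
  by congr pair; rewrite /= scaler0 addr0.
have [|//|c2 c20 H2] := @strongly_continuous_bounded R X (X * X)%type T
  (fun t x => Pi t (0, x)).
  move=> t /bPi[lt [C Ct]]; split; last by exists C => x; rewrite -nr.
  move=> a x y; rewrite -lt; congr (Pi t _).
  by congr pair; rewrite /= scaler0 addr0.
(* |Pi z|^2 <= 2 |Pi z|_max^2 and (c1 a + c2 b)^2 <= 2 (c1^2 + c2^2) (a^2 + b^2). *)
exists (4 * (c1 ^+ 2 + c2 ^+ 2)) => [|t tT [x y]].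
  by rewrite mulr_gt0// addr_gt0// exprn_gt0.
have [lt _] := bPi t tT.
have E : Pi t (x, y) = Pi t (x, 0) + Pi t (0, y).
  rewrite -[Pi t (x, 0)]scale1r -lt scale1r; congr (Pi t _).
  by congr pair; rewrite /= ?addr0 ?add0r.
have h : `|Pi t (x, y)| <= c1 * `|x| + c2 * `|y|.
  by rewrite E (le_trans (ler_normD _ _))// lerD ?H1 ?H2.
have [h1 h2] : `|(Pi t (x, y)).1| <= `|Pi t (x, y)| /\
               `|(Pi t (x, y)).2| <= `|Pi t (x, y)|.
  by rewrite prod_normE !le_max !lexx orbT.
rewrite /pair_ip !ipn /=.
have := normr_ge0 (Pi t (x, y)).1; have := normr_ge0 (Pi t (x, y)).2.
move: h h1 h2; move: `|Pi _ _| `|_.1| `|_.2| (normr_ge0 x) (normr_ge0 y).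
move: `|x| `|y| => a b p p1 p2 a0 b0 h h1 h2 p20 p10.
have q0 : 0 <= p by lra.
have : p1 ^+ 2 <= p ^+ 2 by rewrite ler_pXn2r ?nnegrE.
have : p2 ^+ 2 <= p ^+ 2 by rewrite ler_pXn2r ?nnegrE.
have : p ^+ 2 <= (c1 * a + c2 * b) ^+ 2 by rewrite ler_pXn2r ?nnegrE// (le_trans q0).
have : (c1 * a + c2 * b) ^+ 2 <= 2 * (c1 ^+ 2 + c2 ^+ 2) * (a ^+ 2 + b ^+ 2).
  have := sqr_ge0 (c1 * a - c2 * b).
  have := sqr_ge0 (c1 * b); have := sqr_ge0 (c2 * a).
  by rewrite !sqrrD sqrrN !exprMn; nra.
nra.
Qed.


(** * Operator matrices *)

Section Blocks.
Context {R : realType} {X : completeNormedModType R} {ip : X -> X -> R}.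
Hypotheses (ipI : semi_inner ip) (ipn : forall x, ip x x = `|x| ^+ 2).
Local Notation q := (pair_ip ip).
Let qI : semi_inner q := semi_inner_pair ipI.

(** The blocks have adjoints, that of the lower right one being - Mbar itself. *)
Lemma op_M_has_adj (M Mbar : R -> X -> X) (t : R) :
  bounded_op (M t) -> bounded_op (Mbar t) -> has_adj q (op_M ip M Mbar t).
Proof.
move=> /(bounded_has_adj ipI ipn)/adjE aM.
move=> /(bounded_has_adj ipI ipn)/adjE aMb [y1 y2].
exists (adj ip (M t) y1, - Mbar t y2) => -[x1 x2].
rewrite /pair_ip /op_M /blk /scal /= !scale0r addr0 add0r aM !(innerE ipI).
by rewrite (innerC ipI _ y2) -aMb (innerC ipI x2).
Qed.

Lemma split_columns {F : X * X -> X * X} (x u : X) : bounded_op F ->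
  F (x, u) = F (x, 0) + F (0, u).
Proof.
move=> [lF _]; rewrite -[F (x, 0)]scale1r -lF scale1r; congr (F _).
by congr pair; rewrite /= ?addr0 ?add0r.
Qed.

Lemma block_form (F : X * X -> X * X) (x u : X) : selfadjoint_op q F ->
  q (F (x, u)) (x, u)
    = ip (blk11 F x) x + 2 * ip (blk21 F x) u + ip (blk22 F u) u.
Proof.
move=> [bF sF]; rewrite (split_columns _ _ bF) (innerDl qI).
have := sF (0, u) (x, 0).
rewrite /pair_ip /blk11 /blk21 /blk22 /= !(innerE ipI) add0r addr0 => ->.
rewrite (innerC ipI u); ring.
Qed.

(** At the vector (0, w) the assumed inequality says
    - 2 <Pbar Mbar^* w, w> - <Qbar0 w, w> <= - delta |w|^2, where moreover
    <Pbar Mbar^* w, w> = <Mbar Pbar w, w>. *)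
Lemma lyap22_ge0 (M Mbar Theta Q0 Qbar0 : R -> X -> X) (Pit : X * X -> X * X)
  (t delta : R) :
  bounded_op (M t) -> bounded_op (Mbar t) -> selfadjoint_op q Pit ->
  0 <= delta ->
  le_op q (lyap_sym ip Pit (op_M ip M Mbar t) \- op_Q ip Theta Q0 Qbar0 t)
    (- delta) ->
  linear (Theta t) -> linear (Q0 t) ->
  forall w, 0 <=
    ip (blk22 Pit (adj ip (Mbar t) w) + Mbar t (blk22 Pit w) + Qbar0 t w) w.
Proof.
move=> bM bMb [bP sP] d0 /(le_opP qI) H lT lQ w.
have T0 := linear_at0 lT; have Q00 := linear_at0 lQ; have M0 := linear_at0 bM.1.
have aMb := adjE (bounded_has_adj ipI ipn (Mbar t) bMb).
have aM := adjE (op_M_has_adj M Mbar t bM bMb).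
have := H (0, w).
rewrite /lyap_sym /= !(innerE qI).
rewrite [q (adj _ _ _) _](innerC qI) -aM.
rewrite -sP (innerC qI (Pit _)).
have -> : op_M ip M Mbar t (0, w) = - (0, adj ip (Mbar t) w).
  rewrite /op_M /blk /scal /= M0 scale0r !add0r scale0r add0r.
  by rewrite -[RHS]/(_, _) oppr0.
rewrite -!sP !(innerE qI).
have E : ip (blk22 Pit (adj ip (Mbar t) w)) w
       = ip (blk22 Pit w) (adj ip (Mbar t) w).
  have := sP (0, adj ip (Mbar t) w) (0, w).
  rewrite /pair_ip /blk22 /= !(innerE ipI) !add0r => ->.
  by rewrite innerC.
rewrite (innerDl ipI _ _ w) (innerDl ipI _ _ w) E aMb.
rewrite /pair_ip /op_Q /blk /blk22 /= T0 !(innerE ipI) !add0r.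
have := mulr_ge0 d0 (inner_ge0 ipI w); lra.
Qed.

Lemma gram_le (G : X -> X) (L : R) (x : X) : linear G -> 0 < L ->
  (forall v, `|G v| <= L * `|v|) -> ip (adj ip G (G x)) x = ip (G x) (G x) /\
  ip (G x) (G x) <= L ^+ 2 * ip x x.
Proof.
move=> lG L0 bG; split.
  rewrite innerC// -(adjE (bounded_has_adj ipI ipn G _))//.
  by split=> //; exists L.
by rewrite !ipn -exprMn; apply: lerXn2r; rewrite ?nnegrE ?mulr_ge0 ?(ltW L0).
Qed.

(** * The sign of the (2,2) block along the mild solution *)

Lemma op_integral_ge0 (a b : R) (F : R -> X -> X) (V : X -> X) :
  op_integral a b F V -> (forall s z, a <= s <= b -> 0 <= ip (F s z) z) ->
  forall z, 0 <= ip (V z) z.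
Proof.
move=> FV F0 z.
apply: (bochner_integral_ge0 (fun x => ip x z) `|z| _ _ _ _ _ _ (FV z))
  => [c x y|x|s sab].
- by rewrite !(innerE ipI).
- by rewrite mulrC ip_norm_le.
- exact: F0.
Qed.

Lemma congruence_form (U : X -> X) (G : X -> X) (w : X) : bounded_op U ->
  ip ((U \o G \o adj ip U) w) w = ip (G (adj ip U w)) (adj ip U w).
Proof. by move=> bU /=; rewrite (adjE (bounded_has_adj ipI ipn U bU)). Qed.

(** By the mild formula <Pbar(t) w, w> is the form of Pbar(0) <= 0 at e^{A^* t} w
    minus the integral over s of the form of Pbar Mbar^* + Mbar Pbar + Qbar0 at
    e^{A^* (t - s)} w, which is nonnegative by [lyap22_ge0]. *)
Lemma mild_solution22_le0 (T : R) (S : R -> X -> X) (D : set X) (A : X -> X)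
  (M Mbar Theta Q0 Qbar0 : R -> X -> X) (Pi : R -> X * X -> X * X) (delta : R) :
  0 <= T -> 0 <= delta -> (forall t, 0 <= t -> bounded_op (S t)) ->
  lyapunov_data ip T M Mbar Theta Q0 Qbar0 ->
  mild_solution ip T S D A M Mbar Theta Q0 Qbar0 Pi ->
  le_op ip (blk22 (Pi 0)) (- delta) ->
  (forall t : R, 0 <= t <= T ->
     le_op q (lyap_sym ip (Pi t) (op_M ip M Mbar t) \- op_Q ip Theta Q0 Qbar0 t)
       (- delta)) ->
  forall t w, 0 <= t <= T -> ip (blk22 (Pi t) w) w <= 0.
Proof.
move=> T0 d0 bS [[[bM _ _] [bMb _ _] [bTh _ _] [bQ0 _ _] _] _] mild P0 PM t w tT.
case: mild => -[saPi _] _ /(_ t tT)[V intV ->] _ _.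
move: (tT) => /andP[t0 tT'].
rewrite (innerBl ipI) (congruence_form (S t) _ w (bS t t0)).
have h1 : ip (blk22 (Pi 0) (adj ip (S t) w)) (adj ip (S t) w) <= 0.
  apply: (le_trans ((le_opP ipI _ _).1 P0 _)).
  by rewrite mulNr oppr_le0 mulr_ge0 ?inner_ge0.
suff h2 : 0 <= ip (V w) w by rewrite subr_le0 (le_trans h1).
apply: (op_integral_ge0 _ _ _ _ intV) => s z /andP[s0 st].
have sT : 0 <= s <= T by rewrite s0 (le_trans st).
have bSs : bounded_op (S (t - s)) by apply: bS; rewrite subr_ge0.
rewrite (congruence_form (S (t - s)) _ z bSs) /=.
apply: (lyap22_ge0 M Mbar Theta Q0 Qbar0 (Pi s) s delta) => //.
- exact: bM.
- exact: bMb.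
- exact: saPi.
- exact: PM.
- by have [] := bTh s sT.
- by have [] := bQ0 s sT.
Qed.

(** * The defining inequalities of a Lyapunov operator *)

(** The (2,2) block contributes - d |w|^2, which Young's inequality trades for the
    cross term 2 <F21 x, w>; all that remains is a multiple of |x|^2. *)
Lemma initial_le (F : X * X -> X * X) (c d K : R) :
  selfadjoint_op q F -> 0 < d -> 0 < c ->
  (forall z, q (F z) (F z) <= c * q z z) -> c + c / d + 1 <= K ->
  le_op ip (blk22 F) (- d) ->
  le_op q (F \+ blk (scal (- K)) (scal 0) (scal 0) (scal 0)) 0.
Proof.
move=> sF d0 c0 bF Kge /(le_opP ipI) Fd; apply/(le_opP qI) => -[x w].
rewrite mul0r /= (innerDl qI) block_form//.
have -> : q (blk (scal (- K)) (scal 0) (scal 0) (scal 0) (x, w)) (x, w)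
          = - K * ip x x.
  by rewrite /pair_ip /blk /scal /= !(innerE ipI); ring.
have := bF (x, 0); rewrite /pair_ip /= !(inner0l ipI) addr0.
rewrite -/(blk11 F x) -/(blk21 F x) => h.
have := inner_young ipI (blk11 F x) x _ ltr01; rewrite invr1 !mul1r => h1.
have := inner_young ipI (blk21 F x) w d^-1; rewrite invr_gt0 invrK => /(_ d0) h2.
have h3 := Fd w.
have p1 := inner_ge0 ipI (blk11 F x); have p2 := inner_ge0 ipI (blk21 F x).
have h4 : d^-1 * ip (blk21 F x) (blk21 F x) <= c / d * ip x x.
  by rewrite mulrAC mulrC ler_pM2r ?invr_gt0//; lra.
have h5 : (c + c / d + 1) * ip x x <= K * ip x x by rewrite ler_wpM2r ?inner_ge0.
have p3 := inner_ge0 ipI x; nra.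
Qed.

(** The form equals (1 - rho) times its value at 0, plus rho times its value at
    1, plus (rho - rho^2) (- <F22 k, k>). *)
Lemma terminal_lower (F : X * X -> X * X) (k x : X) (rho d : R) :
  selfadjoint_op q F ->
  0 <= rho <= 1 -> ip (blk22 F k) k <= 0 ->
  d <= ip (blk11 F x) x ->
  d <= ip (blk11 F x) x + 2 * ip (blk21 F x) k + ip (blk22 F k) k ->
  d <= q (F (x, rho *: k)) (x, rho *: k).
Proof.
move=> sF rho01; rewrite block_form//.
have -> : blk22 F (rho *: k) = rho *: blk22 F k.
  have [[lF _] _] := sF.
  have F0 := linear_at0 lF.
  rewrite /blk22 -[RHS]/((rho *: F (0, k)).2) -[rho *: F _]addr0 -F0 -lF.
  congr (F _).2.
  by congr pair; rewrite /= ?scaler0 addr0.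
rewrite !(innerE ipI); move: rho01 => /andP[r0 r1] h1 h2 h3.
have : 0 <= (rho - rho ^+ 2) * - ip (blk22 F k) k.
  by apply: mulr_ge0; [nra|rewrite oppr_ge0].
nra.
Qed.

(** The terminal form at (x, w) is the form of F at (x, rho k x) + (0, w). The
    first summand contributes at least d |x|^2; half of it pays for the cross term
    between the summands and half for mu |k x|^2, while K |w|^2 pays for the rest
    of the terms in w. *)
Lemma terminal_ge (F : X * X -> X * X) (k : X -> X) (rho c d mu L K : R) :
  selfadjoint_op q F -> 0 < d -> 0 < c -> 0 < L -> 0 <= rho <= 1 ->
  (forall z, q (F z) (F z) <= c * q z z) ->
  linear k -> (forall x, `|k x| <= L * `|x|) ->
  (forall w, ip (blk22 F w) w <= 0) ->
  ge_op ip (blk11 F) d ->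
  ge_op ip (blk11 F \+ (adj ip k \o blk21 F) \+ (adj ip (blk21 F) \o k)
               \+ (adj ip k \o blk22 F \o k)) d ->
  0 <= mu -> mu * L ^+ 2 <= d / 2 -> 2 * c * (1 + L ^+ 2) / d + (c + 1) <= K ->
  ge_op q (terminal_form ip rho k F \+
         blk ((- mu) \*: (adj ip k \o k)) (scal 0) (scal 0) (scal K)) 0.
Proof.
move=> sF d0 c0 L0 rho01 bF lk bk F22 /(ge_opP ipI) Fd /(ge_opP ipI) Fk mu0 muL Kge.
apply/(ge_opP qI) => -[x w].
have bk' : bounded_op k by split=> //; exists L.
have ak := adjE (bounded_has_adj ipI ipn k bk').
have [g1 g2] := gram_le k L x lk L0 bk.
rewrite mul0r /= (innerDl qI).
have -> : q (blk ((- mu) \*: (adj ip k \o k)) (scal 0) (scal 0) (scal K) (x, w)) (x, w)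
          = - mu * ip (k x) (k x) + K * ip w w.
  by rewrite /pair_ip /blk /scal /= !(innerE ipI) g1; ring.
have -> : q (terminal_form ip rho k F (x, w)) (x, w)
   = q (F (x, rho *: k x + w)) (x, rho *: k x + w).
  rewrite /terminal_form /blk /scal /= !scale1r scale0r addr0.
  rewrite /pair_ip /= !(innerE ipI) (innerC ipI (adj ip k _)) -ak.
  rewrite (innerC ipI (k x)); ring.
have [lF _] := sF.1.
have sFq : forall z z', q (F z) z' = q z (F z') := sF.2.
(* z0 carries the unperturbed form of [terminal_lower], z1 the perturbation. *)
have -> : (x, rho *: k x + w) = (x, rho *: k x) + (0, w) :> X * X.
  by rewrite -[RHS]/(x + 0, rho *: k x + w) addr0.
have -> : F ((x, rho *: k x) + (0, w)) = F (x, rho *: k x) + F (0, w).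
  by rewrite -[(x, _)]scale1r lF !scale1r.
set z0 := (x, rho *: k x); set z1 := (0, w).
rewrite !(innerE qI) (sFq z1 z0) (innerC qI z1).
have low : d * ip x x <= q (F z0) z0.
  apply: terminal_lower => //.
  have aG : has_adj ip (blk21 F).
    move=> y; exists (F (0, y)).1 => u.
    have := sFq (u, 0) (0, y).
    by rewrite /pair_ip /blk21 /= !(innerE ipI) add0r addr0.
  have := Fk x; rewrite /= !(innerDl ipI) !(innerC ipI (adj ip _ _)).
  rewrite -!ak -(adjE aG) !(innerC ipI (k x)); lra.
have q0 : q z0 z0 <= (1 + L ^+ 2) * ip x x.
  rewrite /pair_ip /= !(innerE ipI); move: rho01 => /andP[r0 r1].
  have : rho * (rho * ip (k x) (k x)) <= ip (k x) (k x).
    by rewrite mulrA ler_piMl ?inner_ge0// mulr_ile1.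
  lra.
have q1 : q z1 z1 = ip w w by rewrite /pair_ip /= !(innerE ipI) add0r.
(* With this weight the first cross term costs at most (d / 2) |x|^2. *)
pose e := d / (2 * (c * (1 + L ^+ 2))).
have L2 : 0 < 1 + L ^+ 2 by rewrite addr_gt0 ?exprn_gt0.
have e0 : 0 < e by rewrite divr_gt0 ?mulr_gt0.
have y1 := inner_youngN qI (F z0) z1 _ e0.
have y2 := inner_youngN qI (F z1) z1 _ ltr01.
rewrite invr1 !mul1r in y2.
have y3 : e * q (F z0) (F z0) <= d / 2 * ip x x.
  apply: (@le_trans _ _ (e * (c * ((1 + L ^+ 2) * ip x x)))).
    by rewrite ler_pM2l// (le_trans (bF z0))// ler_pM2l.
  by rewrite /e le_eqVlt; apply/predU1l; field; rewrite !gt_eqF.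
have y4 : mu * ip (k x) (k x) <= d / 2 * ip x x.
  apply: (@le_trans _ _ (mu * (L ^+ 2 * ip x x))); first by rewrite ler_wpM2l.
  by rewrite mulrA ler_wpM2r// inner_ge0.
have y5 : (e^-1 + (c + 1)) * ip w w <= K * ip w w.
  by rewrite ler_wpM2r ?inner_ge0// /e invf_div (mulrA 2).
have := bF z1; rewrite q1 in y1 y2 * => y6; have p1 := inner_ge0 ipI w.
have p2 : 0 <= c * ip w w by rewrite mulr_ge0// ltW.
lra.
Qed.

(** G stands for the term with mu, which differs between the two types. The
    convex combination leaves the margin delta; G takes half of it and the Schur
    complement the other half. *)
Lemma interior_le (b g : R -> X -> X -> X) (M Mbar Theta Q0 Qbar0 : R -> X -> X)
  (Pit G : X * X -> X * X) (t rho delta mu c K : R) (y psi : X) :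
  selfadjoint_op q Pit -> 0 < delta -> 0 < c -> 0 <= rho <= 1 ->
  (forall z, q (Pit z) (Pit z) <= c * q z z) ->
  c / (delta / 2) <= K ->
  le_op q (lyap_sym ip Pit (op_M ip M Mbar t) \- op_Q ip Theta Q0 Qbar0 t)
    (- delta) ->
  le_op q (lyap_sym ip Pit (op_B b g t y psi)
           \+ lyap_sym ip Pit (op_M ip M Mbar t)
           \- op_Q ip Theta Q0 Qbar0 t) (- delta) ->
  (forall z, mu * q (G z) z <= delta / 2 * q z z) ->
  le_op (pair_ip q)
    (blk (op_H ip b g M Mbar rho t Pit y psi \- op_Q ip Theta Q0 Qbar0 t
            \+ (mu \*: G))
       Pit Pit (scal (- K))) 0.
Proof.
move=> [_ sP] d0 c0 /andP[r0 r1] bP Kge /(le_opP qI) HM /(le_opP qI) HB HG.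
apply: (schur_le_op qI _ _ (delta / 2) c) => //; first by rewrite divr_gt0.
rewrite /op_H; move: HM HB; move: (lyap_sym _ _ (op_B _ _ _ _ _)).
move: (lyap_sym _ _ (op_M _ _ _ _)) (op_Q _ _ _ _ _).
move=> MM Q B HM HB; apply/(le_opP qI) => z; rewrite /=.
rewrite !(innerDl qI) (innerNl qI) !(innerZl qI).
have := HM z; have := HB z; have := HG z; rewrite /= !(innerDl qI) (innerNl qI).
move=> h1 h2 h3.
have h4 : rho * (q (B z) z + q (MM z) z - q (Q z) z) <= rho * (- delta * q z z).
  by rewrite ler_wpM2l.
have h5 : (1 - rho) * (q (MM z) z - q (Q z) z) <= (1 - rho) * (- delta * q z z).
  by rewrite ler_wpM2l// subr_ge0.
lra.
Qed.

Lemma partial_gram_le (G : X -> X) (L mu delta : R) :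
  linear G -> 0 < L -> 0 <= mu ->
  (forall v, `|G v| <= L * `|v|) -> mu * L ^+ 2 <= delta / 2 ->
  forall x, mu * ip (adj ip G (G x)) x <= delta / 2 * ip x x.
Proof.
move=> lG L0 mu0 bG muL x; have [-> h] := gram_le G L x lG L0 bG.
apply: (@le_trans _ _ (mu * (L ^+ 2 * ip x x))); first by rewrite ler_wpM2l.
by rewrite mulrA ler_wpM2r// inner_ge0.
Qed.

End Blocks.

(** * Lyapunov operators of both types *)

Theorem theorem7p1 (R : realType) (X : completeNormedModType R)
  (ip : {dot X for idfun})
  (ip_norm : forall x : X, ip x x = `|x| ^+ 2)
  (X_separable : separable X)
  (T : R) (T_gt0 : 0 < T)
  (S : R -> X -> X) (D : set X) (A : X -> X)
  (S_semigroup : C0_semigroup S) (A_gen : generator S D A)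
  (A_adj : (unb_selfadjoint ip D A /\
              exists2 sigma0 : R, 0 < sigma0 &
                has_sup (spectrum D A) /\ sup (spectrum D A) = - sigma0)
           \/ unb_skewadjoint ip D A)
  (b g : R -> X -> X -> X) (h : X -> X)
  (bgh2 : G2 T b g h) (bgh3 : G3 T b g h)
  (M Mbar Theta Q0 Qbar0 : R -> X -> X)
  (MQ_data : lyapunov_data ip T M Mbar Theta Q0 Qbar0)
  (Pi : R -> X * X -> X * X)
  (Pi_mild : mild_solution ip T S D A M Mbar Theta Q0 Qbar0 Pi)
  (delta : R) (delta_gt0 : 0 < delta)
  (Pbar0_le : le_op ip (blk22 (Pi 0)) (- delta))
  (PT_ge : ge_op ip (blk11 (Pi T)) delta)
  (hT_ge : forall y : X,
     ge_op ip (blk11 (Pi T) \+ (adj ip ('d h y) \o blk21 (Pi T))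
               \+ (adj ip (blk21 (Pi T)) \o 'd h y)
               \+ (adj ip ('d h y) \o blk22 (Pi T) \o 'd h y)) delta)
  (PiM_le : forall t : R, 0 <= t <= T ->
     le_op (pair_ip ip)
       (lyap_sym ip (Pi t) (op_M ip M Mbar t) \- op_Q ip Theta Q0 Qbar0 t)
       (- delta))
  (PiBM_le : forall (t : R) (y psi : X), 0 <= t <= T ->
     le_op (pair_ip ip)
       (lyap_sym ip (Pi t) (op_B b g t y psi)
        \+ lyap_sym ip (Pi t) (op_M ip M Mbar t)
        \- op_Q ip Theta Q0 Qbar0 t)
       (- delta)) :
  lyapunov_type_I ip T S D A b g h Pi /\ lyapunov_type_II ip T S D A b g h Pi.
Proof.
have ipI := semi_inner_dot ip ip_norm.
have qI := semi_inner_pair ipI.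
have T0 := ltW T_gt0; have d0 := ltW delta_gt0.
have [_ _ _ [L L0 [_ bL gL hL]]] := bgh2.
have [_ _ [dfb dfg dfh]] := bgh3.
have bS : forall t, 0 <= t -> bounded_op (S t) by case: S_semigroup.
have [[saPi cPi] _ _ _ _] := Pi_mild.
have bPi t : 0 <= t <= T -> bounded_op (Pi t) by move=> /saPi[].
have [c c0 Pic] := pair_strongly_continuous_bounded ip_norm T Pi bPi cPi.
have P22 w := mild_solution22_le0 ipI ip_norm T S D A _ _ _ _ _ Pi delta T0 d0 bS
  MQ_data Pi_mild Pbar0_le PiM_le T w.
have tT : 0 <= T <= T by apply/andP.
have t0 : 0 <= (0 : R) <= T by apply/andP.
(* mu L^2 = delta / 2: the term with mu takes half of the margin. *)
pose mu := delta / (2 * L ^+ 2).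
(* What the terminal condition requires; it also exceeds the 2 c / delta of the
   interior condition and the c + c / delta + 1 of the initial one. *)
pose K := 2 * c * (1 + L ^+ 2) / delta + (c + 1).
have L2 : 0 < L ^+ 2 by rewrite exprn_gt0.
have mu0 : 0 < mu by rewrite divr_gt0// mulr_gt0.
have muL : mu * L ^+ 2 <= delta / 2.
  by rewrite /mu le_eqVlt; apply/predU1l; field; rewrite gt_eqF.
have cd0 : 0 < c / delta by rewrite divr_gt0.
have cdL : 0 < c / delta * L ^+ 2 by rewrite mulr_gt0.
have KE : K = 2 * (c / delta) + 2 * (c / delta * L ^+ 2) + (c + 1).
  by rewrite /K; field; rewrite gt_eqF.
have K0 : 0 < K by rewrite KE; lra.
have init : lyap_initial ip K Pi.
  by apply: (initial_le ipI _ c delta) => //; [exact: saPi|exact: Pic|lra].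
have schurK : c / (delta / 2) <= K.
  have -> : c / (delta / 2) = 2 * (c / delta) by field; rewrite gt_eqF.
  by rewrite KE; lra.
have dh y v : `|'d h y v| <= L * `|v|.
  by apply: lipschitz_diff; [move=> u; exact: hL|exact: dfh.1].
have term y rho m : 0 <= rho <= 1 -> 0 <= m -> m * L ^+ 2 <= delta / 2 ->
    ge_op (pair_ip ip) (terminal_form ip rho ('d h y) (Pi T) \+
      blk ((- m) \*: (adj ip ('d h y) \o 'd h y)) (scal 0) (scal 0) (scal K)) 0.
  move=> rho01 m0 mL; apply: (terminal_ge ipI ip_norm _ _ _ c delta m L) => //.
  - exact: saPi.
  - exact: Pic.
  - exact: linearP.
  - by move=> w; exact: P22.
have dg t y psi : 0 <= t <= T -> forall v, `|d_y g t y psi v| <= L * `|v|.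
  move=> ht; apply: lipschitz_diff.
    by move=> u; have := gL t ht u psi y psi; rewrite subrr normr0 mulr0 addr0.
  exact: (frechet_partial_differentiable _ _ _ _ (dfg t ht)).1.
have db t y psi : 0 <= t <= T -> forall v, `|d_psi b t y psi v| <= L * `|v|.
  move=> ht; apply: lipschitz_diff.
    by move=> u; have := bL t ht y u y psi; rewrite subrr normr0 mulr0 add0r.
  exact: (frechet_partial_differentiable _ _ _ _ (dfb t ht)).2.
split; (split; first exact: bgh3); exists M, Mbar, Theta, Q0, Qbar0; split=> //;
  exists mu, K; split=> //.
- by move=> y rho rho01; apply: term => //; exact: ltW.
- move=> t y psi rho ht rho01.
  apply: (interior_le ipI _ _ _ _ _ _ _ _ _ _ _ delta _ c) => //.
  + exact: saPi.
  + exact: Pic.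
  + exact: PiM_le.
  + exact: PiBM_le.
  + move=> [x w].
    have G := partial_gram_le ipI ip_norm (d_y g t y psi) L mu delta (linearP _)
      L0 (ltW mu0) (dg t y psi ht) muL x.
    rewrite /pair_ip /blk /scal /= !(innerE ipI).
    have := inner_ge0 ipI w; nra.
(* The terminal condition of type (II) is that of type (I) with mu = 0. *)
- move=> y rho rho01; have := term y rho 0 rho01 (lexx _).
  rewrite mul0r => /(_ (ltW (divr_gt0 delta_gt0 (ltr0Sn _ 1)))).
  rewrite (_ : (- 0) \*: _ = scal 0)//.
  by apply/funext => x; rewrite /= oppr0 /scal !scale0r.
- move=> t y psi rho ht rho01.
  apply: (interior_le ipI _ _ _ _ _ _ _ _ _ _ _ delta _ c) => //.
  + exact: saPi.
  + exact: Pic.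
  + exact: PiM_le.
  + exact: PiBM_le.
  + move=> [x w].
    have G := partial_gram_le ipI ip_norm (d_psi b t y psi) L mu delta (linearP _)
      L0 (ltW mu0) (db t y psi ht) muL w.
    rewrite /pair_ip /blk /scal /= !(innerE ipI).
    have := inner_ge0 ipI x; nra.
Qed.
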